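(* Let $0<\beta<1$ and $c>1$. There exist a constant $C_{\beta,c}<\infty$ and a constant $\eta_0>0$, both depending only on $\beta$ and $c$, such that for every $L_0\ge0$, $L_\beta>0$ and $d\ge1$, the profile $G(s)=L_0+L_\beta\,s^\beta$ ($s\ge 0$) has the following properties. (i) For every $\sigma>0$, $$\mathcal{K}^{(c)}_{d,\sigma}(G)\le C_{\beta,c}\,\left(L_0\,d\,\sigma^2+L_\beta\,d\,\sigma^{2-\beta}+\left(L_\beta\,d\,\sigma^{2-\beta}\right)^{1/(1-\beta)}\right).$$ (ii) For every $0<\eta\le\eta_0$, the choice $\sigma=\eta\,\min\left\{(L_0\,d)^{-1/2},\,(L_\beta\,d)^{-1/(2-\beta)}\right\}$ (with $(L_0 d)^{-1/2}=+\infty$ if $L_0=0$) ensures that $\mathcal{K}^{(c)}_{d,\sigma}(G)\le1/4$.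
   Context: For a continuous nondecreasing $G\colon[0,\infty)\to[0,\infty)$ and $r,s\ge0$, $\Gamma(r,s)$ is the value at time $r$ of the maximal (i.e. pointwise largest) nonnegative solution of $\dot\gamma=G(\gamma)$, $\gamma(0)=s$. Set $\overline{G}(r,s)=2\int_0^1(1-t)\,G(\Gamma(t\,r,s))\,\mathrm{d}t$ and, for $r,\sigma>0$, $\mathcal{K}_{r,\sigma}(G)=\frac{r^2}{2}\,\sup\left\{\frac{\overline{G}(r,s)}{1+\sigma\,s}:s\ge0\right\}$. For $c>1$, $d\ge 1$, $\sigma>0$, $\mathcal{K}^{(c)}_{d,\sigma}(G)$ denotes $\mathcal{K}_{r,\sigma}(G)$ with $r=\sigma\,(c\,d)^{1/2}$. *)

(* Defs.v *)
From mathcomp Require Export all_boot all_order all_algebra.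
From mathcomp Require Export all_classical all_reals all_analysis.

Set Implicit Arguments.
Unset Strict Implicit.
Unset Printing Implicit Defensive.

Export Order.TTheory GRing.Theory Num.Theory.
Export numFieldNormedType.Exports.

Local Open Scope classical_set_scope.
Local Open Scope ring_scope.

(* Functions on [0, +oo[ are encoded as functions R -> R whose values on
   negative arguments are never used. *)

(* Nonnegative solutions g of g' = G(g), g(0) = s, on [0, T].  The derivative at
   t is the limit of difference quotients over points of [0, T], hence two-sided
   for 0 < t < T and one-sided at the endpoints; for T = 0 only the initial
   condition remains. *)
Definition ode_solution (R : realType) (G : R -> R) (T s : R) (g : R -> R) :=
  [/\ g 0 = s,
      forall t, 0 <= t <= T -> 0 <= g t &
      forall t, 0 <= t <= T ->
        (g u - g t) / (u - t) @[u --> within `[0, T] t^'] --> G (g t)].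

Definition maximal_solution (R : realType) (G : R -> R) (T s : R)
    (g : R -> R) :=
  ode_solution G T s g /\
  forall h, ode_solution G T s h -> forall t, 0 <= t <= T -> h t <= g t.

(* Two maximal solutions agree on [0, r], so the set below has at most one
   element; it is empty when the maximal solution blows up before or at time r,
   in which case the value is +oo. *)
Definition Gamma (R : realType) (G : R -> R) (r s : R) : \bar R :=
  xget +oo%E [set y | exists2 g, maximal_solution G r s g & y = (g r)%:E].

(* er_map extends G by G(+oo) = +oo: blow-up only occurs for unbounded G. *)
Definition Gbar (R : realType) (G : R -> R) (r s : R) : \bar R :=
  (2%:E * \int[@lebesgue_measure R]_(t in `[0%R, 1%R])
            ((1 - t)%:E * er_map G (Gamma G (t * r)%R s)))%E.

Definition Kfun (R : realType) (r sigma : R) (G : R -> R) : \bar R :=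
  ((r ^+ 2 / 2)%:E *
   ereal_sup [set Gbar G r s / (1 + sigma * s)%:E | s in `[0%R, +oo[ ])%E.

Definition Kdim (R : realType) (c : R) (d : nat) (sigma : R) (G : R -> R)
    : \bar R :=
  Kfun (sigma * Num.sqrt (c * d%:R)) sigma G.

Definition profile (R : realType) (L0 Lb beta : R) : R -> R :=
  fun s => L0 + Lb * s `^ beta.

(* The minimum is taken in \bar R because (L0 d)^(-1/2) is +oo for L0 = 0,
   whereas powR would give 0; it is finite thanks to its second argument. *)
Definition step_size (R : realType) (L0 Lb beta eta : R) (d : nat) : R :=
  eta * fine (mine
    (if L0 == 0 then +oo%E else ((L0 * d%:R) `^ (- (1 / 2)))%:E)
    ((Lb * d%:R) `^ (- (1 / (2 - beta))))%:E).

(* Main.v *)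
Require Import Defs.
From mathcomp Require Import ring lra.

(* If F is an antiderivative of 1/G (the time needed to reach a level), every
   solution h started at s satisfies F(h(t)) <= F(s) + t, and equality defines
   the maximal solution.  It stays below any M > 0 with s + T G(M) <= M on
   [0, T], because F(M) - F(s) >= (M - s) / G(M) >= T.  For the profile such an
   M is 2 (s + r L0) + (2 r Lb)^(1/(1-beta)), by absorbing the sublinear term.

   Bounding the average defining Gbar by 2 G(M), one is left with
   c d sigma^2 (L0 + Lb M^beta) = c A + c B (sigma M)^beta, where
   A = L0 d sigma^2 and B = Lb d sigma^(2-beta); up to constants sigma M is at
   most (1 + sigma s) (1 + A + B^(1/(1-beta))), and Young's inequality
   concludes.  For the step size of the second part, A and B are at most eta. *)

Set Implicit Arguments.
Unset Strict Implicit.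
Unset Printing Implicit Defensive.

Local Open Scope classical_set_scope.
Local Open Scope ring_scope.

(** Truncation at 0 gives a function continuous on the whole line that agrees with the power on
    nonnegative arguments. At 0 the two one-sided limits are treated separately. *)
Lemma continuous_powR_max0 (R : realType) (a : R) : 0 < a ->
  continuous (fun x : R => Num.max x 0 `^ a).
Proof.
move=> a0 x; case: (ltgtP x 0) => [x0|x0|->].
- rewrite /continuous_at max_r ?(ltW x0)// powR0 ?gt_eqF//.
  apply: cvg_near_cst; near=> u.
  by rewrite max_r ?powR0 ?gt_eqF// ltW//; near: u; exact: lt_nbhsl.
- rewrite /continuous_at max_l ?(ltW x0)//.
  apply: (@cvg_trans _ (u `^ a @[u --> x])).
    apply: near_eq_cvg; near=> u => /=.
    by rewrite max_l// ltW//; near: u; exact: lt_nbhsr.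
  suff : derivable (@powR R ^~ a) x 1 by move=> /derivable1_diffP/differentiable_continuous.
  by apply: derivable_powR; rewrite in_itv/= x0.
- apply/left_right_continuousP; rewrite maxxx powR0 ?gt_eqF//; split.
    apply: cvg_near_cst; near=> u.
    by rewrite max_r ?powR0 ?gt_eqF// ltW.
  apply: (@cvg_trans _ (u `^ a @[u --> (0:R)^'+])); last exact: powR_cvg0.
  apply: near_eq_cvg; near=> u => /=.
  by rewrite max_l// ltW.
Unshelve. all: by end_near. Qed.

(** * Regularity and monotonicity of solutions *)

Section ode.
Context (R : realType).
Implicit Types (G F g h : R -> R) (T s M : R).

(** Clearing the denominator yields an epsilon-delta form that is convenient both for exploiting a
    given solution and for verifying a constructed one. *)
Lemma cvg_slopeP g T (t l : R) :
  (g u - g t) / (u - t) @[u --> within `[0, T] t^'] --> l <->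
  forall e : R, 0 < e -> exists2 d : R, 0 < d & forall u, 0 <= u <= T -> u != t ->
    `|u - t| < d -> `|g u - g t - l * (u - t)| <= e * `|u - t|.
Proof.
have slopeE u e : u != t ->
    (`|l - (g u - g t) / (u - t)| <= e) = (`|g u - g t - l * (u - t)| <= e * `|u - t|).
  move=> ut; have ut0 : u - t != 0 by rewrite subr_eq0.
  by rewrite distrC -[RHS]ler_pdivrMr ?normr_gt0// -normf_div [in RHS]mulrBl mulfK.
split=> [/cvgrPdist_le gl e e0|gl].
  have := gl _ e0; rewrite near_withinE near_withinE => -[d/= d0 dP].
  exists d => // u uT ut utd; rewrite -slopeE//.
  by apply: dP; rewrite //= distrC.
apply/cvgrPdist_le => e e0; have [d d0 dP] := gl _ e0.
rewrite near_withinE near_withinE; exists d => // u/= utd ut.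
by rewrite in_itv/= => uT; rewrite slopeE//; apply: dP => //; rewrite distrC.
Qed.

Lemma ode_solution_continuous G T s g : ode_solution G T s g ->
  {within `[0, T], continuous g}.
Proof.
move=> [_ _ gG]; apply/subspace_continuousP => t /=; rewrite in_itv/= => tT.
have [d d0 dP] := (cvg_slopeP _ _ _ _).1 (gG t tT) 1 ltr01.
apply/cvgrPdist_le => e e0; rewrite near_withinE.
(* The slope estimate with error 1 bounds the increment near [t] by [K |u - t|]. *)
pose K := 1 + `|G (g t)|.
have K0 : 0 < K by rewrite ltr_wpDr.
exists (Num.min d (e / K)) => /=; first by rewrite lt_min d0 divr_gt0.
move=> u/=; rewrite in_itv/= lt_min ltr_pdivlMr// => /andP[ud ue] uT.
have [->|ut] := eqVneq u t; first by rewrite subrr normr0 ltW.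
rewrite distrC; rewrite distrC in ud ue; apply: le_trans (ltW ue).
have := dP u uT ut ud; rewrite mul1r => utG.
rewrite -(subrK (G (g t) * (u - t)) (g u - g t)).
have -> : `|u - t| * K = `|u - t| + `|G (g t) * (u - t)|.
  by rewrite /K normrM; ring.
by rewrite (le_trans (ler_normD _ _))// lerD2r.
Qed.

Lemma ode_solution_is_derive G T s g t : ode_solution G T s g -> 0 < t < T ->
  is_derive t 1 g (G (g t)).
Proof.
move=> [_ _ gG] /andP[t0 tT].
have /gG/cvg_slopeP dg : 0 <= t <= T by rewrite !ltW.
suff gt : h^-1 *: (g (h *: 1 + t) - g t) @[h --> 0^'] --> G (g t).
  by apply: DeriveDef; [apply/cvg_ex; exists (G (g t))|exact: cvg_lim].
apply/cvgrPdist_le => e e0; have [d d0 dP] := dg e e0.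
(* The radius [min t (T - t)] keeps [t + h] in [[0, T]], where the one-variable limit within the
   interval is two-sided. *)
rewrite near_withinE; exists (Num.min d (Num.min t (T - t))).
  by rewrite /= !lt_min d0 t0 subr_gt0.
move=> h/=; rewrite sub0r normrN !lt_min => /and3P[hd ht hT] h0.
have := dP (h *: 1 + t).
rewrite scaler1 addrK => /(_ _ _ hd) dP'.
have {dP'} : `|g (h + t) - g t - G (g t) * h| <= e * `|h|.
  move: ht hT; rewrite !ltr_norml => /andP[? ?] /andP[? ?].
  apply: dP'; first by apply/andP; split; lra.
  by rewrite -subr_eq0 addrK.
rewrite -ler_pdivrMr ?normr_gt0// -normf_div mulrBl mulfK// distrC.
by rewrite [_ *: _]mulrC.
Qed.

Lemma ode_solution_ndecr G T s g : (forall x, 0 <= x -> 0 <= G x) ->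
  ode_solution G T s g ->
  forall t u, 0 <= t -> t <= u -> u <= T -> g t <= g u.
Proof.
move=> G0 sg t u t0 tu uT; have [_ g0 _] := sg.
apply: (@ger0_derive1_ndecr _ g 0 T) => //.
- move=> x; rewrite in_itv/= => xT.
  by case: (ode_solution_is_derive sg xT).
- move=> x; rewrite in_itv/= => /[dup] xT /andP[x0 x1].
  have ? := ode_solution_is_derive sg xT.
  by rewrite derive1E derive_val G0// g0// !ltW.
- exact: ode_solution_continuous sg.
Qed.

End ode.

(* F has derivative 1/G on ]0, +oo[ only, so that G(0) = 0 is allowed. *)
Definition time_map (R : realType) (G F : R -> R) :=
  (forall x : R, 0 <= x -> {for x, continuous F}) /\
  (forall x : R, 0 < x -> is_derive x 1 F (G x)^-1).

(** * Comparison and existence through the time map *)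

Section maximal.
Context (R : realType) (G F : R -> R).
Hypothesis G_gt0 : forall x : R, 0 < x -> 0 < G x.
Hypothesis timeF : time_map G F.
Implicit Types (g h : R -> R) (x y T s M : R).

Lemma time_map_within_continuous x y : 0 <= x ->
  {within `[x, y], continuous F}.
Proof.
move=> x0; apply: continuous_in_subspaceT => z /[!inE]/=.
by rewrite in_itv/= => /andP[xz _]; apply: timeF.1; exact: le_trans xz.
Qed.

Lemma time_map_MVT x y : 0 <= x -> x < y ->
  exists2 z, x < z < y & F y - F x = (G z)^-1 * (y - x).
Proof.
move=> x0 xy.
have dF z : z \in `]x, y[ -> is_derive z 1 F (G z)^-1.
  by rewrite in_itv/= => /andP[xz _]; apply: timeF.2; exact: le_lt_trans xz.
have [z zxy ->] := MVT xy dF (time_map_within_continuous x0).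
by exists z => //; rewrite in_itv in zxy.
Qed.

Lemma time_map_incr x y : 0 <= x -> x < y -> F x < F y.
Proof.
move=> x0 xy; have [z /andP[xz zy] Fxy] := time_map_MVT x0 xy.
rewrite -subr_gt0 Fxy mulr_gt0 ?subr_gt0// invr_gt0 G_gt0//.
exact: le_lt_trans xz.
Qed.

Lemma time_map_le x y : 0 <= x -> 0 <= y -> (F x <= F y) = (x <= y).
Proof.
move=> x0 y0; have [xy|yx|->] := ltgtP x y; last by rewrite lexx.
  by rewrite ltW// time_map_incr.
by apply/negbTE; rewrite -ltNge time_map_incr.
Qed.

Hypothesis G_ge0 : forall x : R, 0 <= x -> 0 <= G x.

(** Along [h] the derivative of [F \o h] is [G h / G h = 1] wherever [h > 0]. This may fail at the
    start if [s = 0], so the estimate is first proved from any level [y] strictly above [s], and [y]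
    is then taken close to [s]. *)
Lemma time_map_solution_le T s h t : ode_solution G T s h -> 0 <= t <= T ->
  F (h t) <= F s + t.
Proof.
move=> sh /andP[t0 tT]; have [h0 hge _] := sh.
have s0 : 0 <= s by rewrite -h0 hge// lexx (le_trans t0).
have ht0 : 0 <= h t by rewrite hge// t0.
have sht : s <= h t by rewrite -h0 (ode_solution_ndecr G_ge0 sh).
have [->|sNht] := eqVneq (h t) s; first by rewrite lerDl.
have {sNht} sht' : s < h t by rewrite lt_neqAle eq_sym sNht.
have ch := ode_solution_continuous sh.
have key y : s < y < h t -> F (h t) - F y <= t.
  move=> /andP[sy yh].
  (* [a] is a time at which [h] equals [y]. From then on [h >= y > 0], and the mean value theorem on
     [[a, t]] gives [F (h t) - F y = t - a <= t]. *)
  have [||a] := @IVT _ h 0 t y t0.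
  - apply: continuous_subspaceW ch => z/=; rewrite !in_itv/= => /andP[-> zt].
    exact: le_trans tT.
  - by rewrite h0 min_l ?max_r// (ltW sy) ltW.
  rewrite in_itv/= => /andP[a0 at_] hay.
  have {}at_ : a < t.
    by rewrite lt_neqAle at_ andbT; apply/eqP => aE; rewrite -hay aE ltxx in yh.
  have hgt0 z : a <= z -> z <= t -> 0 < h z.
    move=> az zt; apply: (le_lt_trans s0); apply: (lt_le_trans sy).
    by rewrite -hay (ode_solution_ndecr G_ge0 sh)// (le_trans zt).
  have dFh z : z \in `]a, t[ -> is_derive z 1 (F \o h) 1.
    rewrite in_itv/= => /andP[az zt].
    have hz := hgt0 _ (ltW az) (ltW zt).
    have zT : 0 < z < T by rewrite (le_lt_trans a0)// (lt_le_trans zt).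
    rewrite -[X in is_derive _ _ _ X](mulVf (lt0r_neq0 (G_gt0 hz))).
    apply: is_derive1_comp; first exact: timeF.2.
    exact: ode_solution_is_derive sh zT.
  have cFh : {within `[a, t], continuous (F \o h)}.
    apply/subspace_continuousP => z/= zat.
    have := zat; rewrite in_itv/= => /andP[az zt].
    have cah : {within `[a, t], continuous h}.
      apply: continuous_subspaceW ch => w/=; rewrite !in_itv/= => /andP[aw wt].
      by rewrite (le_trans a0)//= (le_trans wt).
    move/subspace_continuousP : cah => /(_ z zat) hz.
    apply: (cvg_comp _ _ hz).
    by apply: timeF.1; rewrite ltW// hgt0.
  have [z _] := MVT at_ dFh cFh.
  by rewrite /= hay mul1r => ->; rewrite gerBl.
rewrite leNgt; apply/negP => Fht.
have e0 : 0 < F (h t) - (F s + t) by rewrite subr_gt0.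
have /cvgrPdist_lt/(_ _ e0)[d/= d0 dP] : {for s, continuous F} by exact: timeF.1.
(* This [y] lies strictly between [s] and [h t], and so close to [s] that [F y] differs from [F s]
   by less than the assumed excess. *)
pose y := Num.min (s + d / 2) ((s + h t) / 2).
have sy : s < y by rewrite /y lt_min; apply/andP; split; lra.
have yh : y < h t by rewrite /y gt_min; apply/orP; right; lra.
have yd : y <= s + d / 2 by rewrite /y ge_min lexx.
have /dP : `|s - y| < d by rewrite ltr_norml; apply/andP; split; lra.
rewrite ltr_norml => /andP[+ _].
by have := key y; rewrite sy yh => /(_ isT); lra.
Qed.

Hypothesis G_ndecr : forall x y : R, 0 <= x -> x <= y -> G x <= G y.
Hypothesis G_cont : continuous (fun x : R => G (Num.max x 0)).

(** The solution inverts the time map, [F (g t) = F s + t]. The intermediate value theorem on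
    [[s, M]] provides it; [time_map_solution_le] and the monotonicity of [F] make it maximal. *)
Lemma ode_maximal_solution_ex T s M : 0 <= s -> 0 <= T -> 0 < M ->
  s + T * G M <= M ->
  exists2 g, maximal_solution G T s g & 0 <= g T <= M.
Proof.
move=> s0 T0 M0 sM.
have GM0 : 0 < G M by exact: G_gt0.
have sleM : s <= M by apply: le_trans sM; rewrite lerDl mulr_ge0// ltW.
have FT : F s + T <= F M.
  (* If [s = M], the hypothesis forces [T <= 0]. Otherwise [F M - F s = (M - s) / G z] with
     [G z <= G M]. *)
  move: sleM; rewrite le_eqVlt => /predU1P[sEM|slM].
    move: sM; rewrite sEM gerDl pmulr_lle0// => T0'.
    by rewrite gerDl.
  have [z /andP[sz zM] FzE] := time_map_MVT s0 slM.
  rewrite -lerBrDl FzE mulrC ler_pdivlMr; last first.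
    by apply: G_gt0; exact: le_lt_trans sz.
  apply: le_trans (_ : T * G M <= _); last by rewrite lerBrDl.
  by rewrite ler_wpM2l// G_ndecr ?(ltW zM)// (le_trans s0)// ltW.
have ex t : exists y, 0 <= t <= T -> s <= y <= M /\ F y = F s + t.
  have [/andP[t0 tT]|_] := boolP (0 <= t <= T); last by exists 0.
  have FsM : F s <= F M by rewrite time_map_le// (le_trans s0).
  have [||y] := @IVT _ F s M (F s + t) sleM.
  - exact: time_map_within_continuous s0.
  - by rewrite min_l// max_r// lerDl t0/= (le_trans _ FT)// lerD2l.
  by rewrite in_itv/= => ysM Fy; exists y.
have {ex} [g gP] := choice ex.
have g_ge t : 0 <= t <= T -> 0 <= g t.
  by move=> /gP[/andP[sg _] _]; exact: le_trans sg.
have TT : 0 <= T <= T by rewrite T0 lexx.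
(* This is the mean value theorem for [F] between [g t] and [g u], solved for [g u - g t]. *)
have slope t u : 0 <= t -> t < u -> u <= T ->
    exists2 z, g t < z < g u & g u - g t = G z * (u - t).
  move=> t0 tu uT.
  have tT' : 0 <= t <= T by rewrite t0 (le_trans (ltW tu)).
  have uT' : 0 <= u <= T by rewrite uT (le_trans t0)// ltW.
  have [_ Fgt] := gP t tT'; have [_ Fgu] := gP u uT'.
  have gtu : g t < g u.
    by rewrite ltNge -time_map_le ?g_ge// Fgt Fgu -ltNge ltrD2l.
  have [z /[dup] zP /andP[z1 z2] FzE] := time_map_MVT (g_ge _ tT') gtu.
  exists z => //; have -> : u - t = F (g u) - F (g t) by rewrite Fgt Fgu; ring.
  rewrite FzE mulrA mulfV ?mul1r// gt_eqF// G_gt0//.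
  exact: le_lt_trans (g_ge _ tT') z1.
have slope2 t u : 0 <= t <= T -> 0 <= u <= T -> exists z,
    [/\ 0 <= z <= M, `|z - g t| <= `|g u - g t| & g u - g t = G z * (u - t)].
  move=> /[dup] tT /andP[t0 t1] /[dup] uT /andP[u0 u1].
  have [/andP[sgt gtM] _] := gP _ tT; have [/andP[sgu guM] _] := gP _ uT.
  have [tu|ut|->] := ltgtP t u.
  - have [z /andP[z1 z2] zE] := slope _ _ t0 tu u1; exists z; split => //.
      by apply/andP; split; lra.
    by rewrite !ger0_norm; lra.
  - have [z /andP[z1 z2] zE] := slope _ _ u0 ut t1; exists z; split.
    + by apply/andP; split; lra.
    + by rewrite !ler0_norm; lra.
    + by rewrite -opprB zE; ring.
  - exists (g u); split; rewrite ?subrr ?mulr0//.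
    by apply/andP; split; lra.
exists g; last first.
  by have [/andP[_ ->] _] := gP _ TT; rewrite g_ge.
split.
  split=> //.
  - have T0' : 0 <= (0:R) <= T by rewrite lexx.
    have [/andP[sg0 _] Fg0] := gP _ T0'.
    apply/eqP; rewrite eq_le sg0 andbT -time_map_le ?g_ge// Fg0 addr0//.
  - move=> t tT; apply/cvg_slopeP => e e0.
    have gt0 := g_ge _ tT.
    have /cvgrPdist_le/(_ _ e0)[d/= d0 dP] :
        {for g t, continuous (fun x : R => G (Num.max x 0))} by exact: G_cont.
    (* [g] is Lipschitz with constant [G M], so this radius keeps the intermediate point [z] within
       [d] of [g t], where [G] varies by at most [e]. *)
    exists (d / G M); first by rewrite divr_gt0.
    move=> u uT ut; rewrite ltr_pdivlMr// => utd.
    have [z [/andP[z0 zM] zt gut]] := slope2 t u tT uT.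
    rewrite gut -mulrBl normrM ler_wpM2r// distrC.
    have := dP z; rewrite !max_l//; apply.
    rewrite /= distrC (le_lt_trans zt)// gut normrM mulrC.
    apply: le_lt_trans utd; rewrite ler_wpM2l// ger0_norm ?G_ge0//.
    exact: G_ndecr.
move=> h sh t tT.
have [_ hge _] := sh.
rewrite -time_map_le ?hge ?g_ge//.
by have [_ ->] := gP _ tT; exact: time_map_solution_le sh tT.
Qed.

(** Two maximal solutions bound each other at [T], so the set in [Gamma] is a singleton and [xget]
    does not fall back on its default [+oo]. *)
Lemma Gamma_le T s M : 0 <= s -> 0 <= T -> 0 < M -> s + T * G M <= M ->
  exists2 y, Gamma G T s = y%:E & 0 <= y <= M.
Proof.
move=> s0 T0 M0 sM; have [g mg gM] := ode_maximal_solution_ex s0 T0 M0 sM.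
exists (g T) => //; apply: xget_unique; first by exists g.
move=> _ [h mh ->]; congr EFin; apply/eqP.
have TT : 0 <= T <= T by rewrite T0 lexx.
by rewrite eq_le (mg.2 _ mh.1 _ TT) (mh.2 _ mg.1 _ TT).
Qed.

End maximal.

(** * The profile and its time map *)

Section profile.
Context (R : realType) (L0 Lb beta : R).
Hypothesis beta_gt0 : 0 < beta.
Hypothesis L0_ge0 : 0 <= L0.
Hypothesis Lb_gt0 : 0 < Lb.
Implicit Types x y : R.

Local Notation G := (profile L0 Lb beta).

Lemma profile_ge0 x : 0 <= x -> 0 <= G x.
Proof. by move=> x0; rewrite addr_ge0// mulr_ge0 ?powR_ge0// ltW. Qed.

Lemma profile_gt0 x : 0 < x -> 0 < G x.
Proof. by move=> x0; rewrite ltr_wpDl// mulr_gt0 ?powR_gt0. Qed.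

Lemma profile_ndecr x y : 0 <= x -> x <= y -> G x <= G y.
Proof.
move=> x0 xy; rewrite lerD2l ler_wpM2l ?(ltW Lb_gt0)//.
by rewrite (ge0_ler_powR (ltW beta_gt0)) ?nnegrE// (le_trans x0).
Qed.

Lemma profile_max0_continuous : continuous (fun x => G (Num.max x 0)).
Proof.
move=> x; apply: cvgD; first exact: cvg_cst.
by apply: cvgMr; exact: continuous_powR_max0.
Qed.

(** For [L0 = 0], [1/G] is singular at 0 but integrable, and a multiple of the power [1 - beta] is
    an antiderivative. For [L0 > 0], [1/G] extends continuously and the fundamental theorem of
    calculus applies. *)
Lemma profile_time_map_ex : beta < 1 -> exists F, time_map G F.
Proof.
move=> beta1; move: L0_ge0; rewrite le_eqVlt => /predU1P[L00|L0_gt0].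
  have b1 : 0 < 1 - beta by rewrite subr_gt0.
  pose K := ((1 - beta) * Lb)^-1.
  exists (fun x => K *: Num.max x 0 `^ (1 - beta)); split=> x x0.
    by apply: cvgZr; exact: continuous_powR_max0.
  have -> : (G x)^-1 = K *: ((1 - beta) * x `^ (1 - beta - 1)).
    rewrite /profile -L00 add0r /K -[_ *: _]/(_ * _).
    have -> : 1 - beta - 1 = - beta by ring.
    by rewrite powRN; field; rewrite !gt_eqF// powR_gt0.
  apply: is_deriveZ.
  apply: (@near_eq_is_derive _ _ _ (@powR R ^~ (1 - beta))); last exact: is_derive1_powR.
  by near=> u; rewrite max_l// ltW//; near: u; exact: lt_nbhsr.
pose k x := (G (Num.max x 0))^-1.
have kc : continuous k.
  move=> x; apply: cvgV; last exact: profile_max0_continuous.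
  by rewrite gt_eqF// ltr_pwDl// mulr_ge0 ?powR_ge0// ltW.
(* Integrating from -1 makes 0 an interior point, so that [F] is differentiable, hence continuous,
   at 0 too. *)
pose F x : R := \int[lebesgue_measure]_(t in `[-1, x]) k t.
have dF x : 0 <= x -> derivable F x 1 /\ derive1 F x = (G x)^-1.
  move=> x0; have -> : G x = G (Num.max x 0) by rewrite max_l.
  apply: (@continuous_FTC1 _ k (BLeft (-1)) x (x + 1)).
  - by rewrite ltrDl.
  - apply: continuous_compact_integrable; first exact: segment_compact.
    exact: continuous_subspaceT.
  - by rewrite lte_fin; lra.
  - exact: kc.
exists F; split=> x x0.
  have [dFx _] := dF x x0.
  by move/derivable1_diffP/differentiable_continuous : dFx.
by have [dFx <-] := dF x (ltW x0); rewrite derive1E; exact: DeriveDef.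
Unshelve. all: by end_near. Qed.

End profile.

(* ge0_le_integral without measurability: an integral of a nonnegative function
   is a supremum over simple functions below it. *)
Lemma ge0_le_integral_nonmeas d (T : measurableType d) (R : realType)
    (mu : {measure set T -> \bar R}) (D : set T) (f1 f2 : T -> \bar R) :
  (forall x, D x -> (0 <= f1 x)%E) -> (forall x, D x -> (f1 x <= f2 x)%E) ->
  (\int[mu]_(x in D) f1 x <= \int[mu]_(x in D) f2 x)%E.
Proof.
move=> f10 f12.
have f20 x : D x -> (0 <= f2 x)%E by move=> Dx; exact: le_trans (f10 _ Dx) (f12 _ Dx).
rewrite !ge0_integralE//; apply: ereal_sup_le => _ [h hf <-]; exists h => // x.
by apply: le_trans (hf x) _; exact: lee_restrict.
Qed.

(** * Bound on the averaged growth *)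

Section Gbar_bound.
Context (R : realType) (L0 Lb beta : R).
Hypothesis beta_gt0 : 0 < beta.
Hypothesis beta_lt1 : beta < 1.
Hypothesis L0_ge0 : 0 <= L0.
Hypothesis Lb_gt0 : 0 < Lb.

Local Notation G := (profile L0 Lb beta).

(** The condition on [M] persists when [r] is replaced by [t r] with [t <= 1], so [Gamma] stays in
    [[0, M]] throughout the average. Bounding the weight [1 - t] by 1 costs a factor 2. *)
Lemma Gbar_profile_le (r s M : R) : 0 <= s -> 0 <= r -> 0 < M ->
  s + r * G M <= M -> (Gbar G r s <= (2 * G M)%:E)%E.
Proof.
move=> s0 r0 M0 sM; rewrite /Gbar EFinM lee_wpmul2l//.
have GM0 : 0 <= G M by apply: profile_ge0 => //; exact: ltW.
have [F tF] := profile_time_map_ex beta_gt0 L0_ge0 Lb_gt0 beta_lt1.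
have GammaE t : 0 <= t <= 1 ->
    exists2 y, Gamma G (t * r) s = y%:E & 0 <= y <= M.
  move=> /andP[t0 t1]; apply: (Gamma_le _ tF) => //.
  - by move=> x; exact: profile_gt0.
  - by move=> x; exact: profile_ge0.
  - by move=> x y; exact: profile_ndecr.
  - exact: profile_max0_continuous.
  - exact: mulr_ge0.
  - by apply: le_trans sM; rewrite lerD2l ler_wpM2r// ler_piMl.
apply: (@le_trans _ _ (\int[lebesgue_measure]_(t in `[0%R, 1%R]) (cst (G M)%:E t))%E).
  apply: ge0_le_integral_nonmeas => t; rewrite /= in_itv/= => t01.
    have [y -> /andP[y0 yM]] := GammaE t t01; have /andP[t0 t1] := t01.
    by rewrite /= -EFinM lee_fin mulr_ge0 ?profile_ge0// subr_ge0.
  have [y -> /andP[y0 yM]] := GammaE t t01; have /andP[t0 t1] := t01.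
  rewrite /= -EFinM lee_fin; apply: (@le_trans _ _ (1 * G M)); last by rewrite mul1r.
  by rewrite ler_pM ?subr_ge0 ?profile_ge0 ?profile_ndecr ?gerBl.
have m01 : @lebesgue_measure R [set` `[0, 1]] = 1%E.
  by rewrite lebesgue_measure_itv/= lte_fin ltr01 oppr0 addr0.
rewrite integral_cst; last exact: measurable_itv.
by rewrite [X in (_ * X <= _)%E]m01 mule1.
Qed.

End Gbar_bound.

(** * Absorption and Young-type inequalities *)

Section estimates.
Context (R : realType) (beta : R).
Hypothesis beta_gt0 : 0 < beta.
Hypothesis beta_lt1 : beta < 1.
Implicit Types x y : R.

Local Notation p := (1 / (1 - beta)).

(** Since [p (1 - beta) = 1], [y] equals [(y^p)^(1 - beta)], which is at most [x^(1 - beta)]; the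
    exponents [1 - beta] and [beta] add up to 1. *)
Lemma mulr_powR_le x y : 0 <= y -> y `^ p <= x -> y * x `^ beta <= x.
Proof.
move=> y0 yx; have b1 : 0 < 1 - beta by rewrite subr_gt0.
have x0 : 0 <= x by apply: le_trans yx; exact: powR_ge0.
have -> : y = (y `^ p) `^ (1 - beta).
  by rewrite -powRrM mul1r mulVf ?gt_eqF// powRr1.
have xE : x `^ (1 - beta) * x `^ beta = x.
  by rewrite -powRD subrK ?powRr1// oner_eq0.
rewrite -[leRHS]xE.
rewrite ler_wpM2r ?powR_ge0//.
by rewrite (ge0_ler_powR (ltW b1)) ?nnegrE ?powR_ge0.
Qed.

(** A form of Young's inequality: enlarging [x] to [x + y^p] brings it into the range of
    [mulr_powR_le]. *)
Lemma mulr_powR_le_add x y : 0 <= x -> 0 <= y -> y * x `^ beta <= x + y `^ p.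
Proof.
move=> x0 y0; have z0 : 0 <= y `^ p by exact: powR_ge0.
apply: (@le_trans _ _ (y * (x + y `^ p) `^ beta)); last first.
  by apply: mulr_powR_le => //; rewrite lerDr.
rewrite ler_wpM2l// (ge0_ler_powR (ltW beta_gt0)) ?nnegrE ?addr_ge0//.
by rewrite lerDl.
Qed.

(* The case split makes the term [2 B] appear rather than the constant [2],
   which is not controlled when [B] is small. *)
Lemma mulr_powR_interp (a b k : R) : 0 <= a -> 0 <= b -> 0 <= k ->
  b * (2 + a + k * b `^ p) `^ beta <= 2 * b + a + (k + 1) * b `^ p.
Proof.
move=> a0 b0 k0; set Q := 2 + a + k * b `^ p.
have bp0 : 0 <= b `^ p by exact: powR_ge0.
have kbp0 : 0 <= k * b `^ p by exact: mulr_ge0.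
have Q1 : 1 <= Q by rewrite /Q; lra.
have [b1|/ltW b1] := leP b 1.
  apply: (@le_trans _ _ (b * Q)).
    by rewrite ler_wpM2l// ler1_powR// ltW.
  have : b * a <= 1 * a by rewrite ler_wpM2r.
  have : b * (k * b `^ p) <= 1 * (k * b `^ p) by rewrite ler_wpM2r.
  by rewrite /Q; lra.
have := mulr_powR_le_add (le_trans ler01 Q1) b0.
by rewrite /Q; lra.
Qed.

(** * The level [M] for the profile and its scaling *)

Section growth.
Context (L0 Lb : R).
Hypothesis L0_ge0 : 0 <= L0.
Hypothesis Lb_gt0 : 0 < Lb.

Definition growth_bound (r s : R) := 2 * (s + r * L0) + (2 * r * Lb) `^ p.

Lemma growth_bound_gt0 r s : 0 < r -> 0 <= s -> 0 < growth_bound r s.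
Proof.
move=> r0 s0; rewrite ltr_wpDl ?powR_gt0 ?mulr_gt0//.
by rewrite mulr_ge0// addr_ge0// mulr_ge0// ltW.
Qed.

(** Half of the level pays for [s + r L0], the other half for [r Lb M^beta], by absorption with
    [y = 2 r Lb]. *)
Lemma growth_boundP r s : 0 < r -> 0 <= s ->
  s + r * profile L0 Lb beta (growth_bound r s) <= growth_bound r s.
Proof.
move=> r0 s0; set M := growth_bound r s.
have y0 : 0 <= 2 * r * Lb by rewrite !mulr_ge0 ?ltW.
have u0 : 0 <= 2 * (s + r * L0) by rewrite mulr_ge0// addr_ge0// mulr_ge0// ltW.
have H1 : 2 * r * Lb * M `^ beta <= M by apply: mulr_powR_le => //; rewrite lerDr.
have H2 : 2 * (s + r * L0) <= M by rewrite lerDl powR_ge0.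
by rewrite /profile; lra.
Qed.

(** With [k = (2c)^p], the bracket dominates the coefficients [1 + 2c], [2] and [k + 1] that [A],
    [B] and [B^p] acquire in [growth_bound_profile_le]. *)
Definition profile_const (c : R) := c * (4 + 2 * c + (2 * c) `^ p).

Lemma growth_bound_profile_le (c sigma s : R) (d : nat) :
  1 < c -> 0 < sigma -> 0 <= s -> (1 <= d)%N ->
  (sigma * Num.sqrt (c * d%:R)) ^+ 2 *
    profile L0 Lb beta (growth_bound (sigma * Num.sqrt (c * d%:R)) s) <=
  profile_const c * (L0 * d%:R * sigma ^+ 2 + Lb * d%:R * sigma `^ (2 - beta)
    + (Lb * d%:R * sigma `^ (2 - beta)) `^ p) * (1 + sigma * s).
Proof.
move=> c1 sigma0 s0 d1; set r := sigma * Num.sqrt _.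
set B := Lb * d%:R * sigma `^ (2 - beta).
have b1 : 0 < 1 - beta by rewrite subr_gt0.
have p0 : 0 <= p by rewrite divr_ge0// ltW.
pose D : R := d%:R; pose A := L0 * D * sigma ^+ 2.
have D1 : 1 <= D by rewrite /D ler1n.
have D0 : 0 < D by exact: lt_le_trans D1.
have c0 : 0 < c by exact: lt_trans c1.
have cD1 : 1 <= c * D by rewrite (le_trans D1)// ler_peMl ?(ltW D0) ?(ltW c1).
have cD0 : 0 <= c * D by exact: le_trans cD1.
pose q := Num.sqrt (c * D).
have q0 : 0 <= q by exact: sqrtr_ge0.
have q2 : q ^+ 2 = c * D by rewrite sqr_sqrtr.
(* As [c D >= 1], its root is at most [c D]. This trades the root of the dimension for the
   dimension, so that [A] and [B] control the [L0] and [Lb] terms of [sigma M]. *)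
have qD : q <= c * D.
  have q1 : 1 <= q by rewrite -sqrtr1 ler_sqrt.
  by rewrite -q2 expr2 ler_peMr.
have sigmab0 x : 0 < sigma `^ x by exact: powR_gt0.
have A0 : 0 <= A by rewrite /A !mulr_ge0 ?exprn_ge0 ?(ltW D0) ?(ltW sigma0).
have B0 : 0 <= B by rewrite /B !mulr_ge0 ?(ltW Lb_gt0) ?(ltW D0) ?(ltW (sigmab0 _)).
have Bp0 : 0 <= B `^ p by exact: powR_ge0.
set M := growth_bound r s.
have M0 : 0 <= M.
  rewrite /M /growth_bound addr_ge0 ?powR_ge0// mulr_ge0// addr_ge0//.
  by rewrite !mulr_ge0// ltW.
pose k := (2 * c) `^ p.
have k0 : 0 <= k by exact: powR_ge0.
pose w := 1 + sigma * s.
have w1 : 1 <= w by rewrite lerDl mulr_ge0// ltW.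
have w0 : 0 <= w by exact: le_trans w1.
pose Q := 2 + 2 * c * A + k * B `^ p.
have cA0 : 0 <= 2 * c * A by rewrite !mulr_ge0// ltW.
have kB0 : 0 <= k * B `^ p by exact: mulr_ge0.
have Q0 : 0 <= Q by rewrite /Q; lra.
have rA : sigma * (r * L0) <= c * A.
  have -> : sigma * (r * L0) = sigma ^+ 2 * L0 * q by rewrite /r /q /D; ring.
  have -> : c * A = sigma ^+ 2 * L0 * (c * D) by rewrite /A; ring.
  by rewrite ler_wpM2l// mulr_ge0// exprn_ge0// ltW.
have rB : sigma * (2 * r * Lb) `^ p <= k * B `^ p.
  (* [sigma] enters the power as [sigma^(1 - beta)]; with the [sigma] contained in [r] it forms the
     factor [sigma^(2 - beta)] of [B]. *)
  have -> : sigma * (2 * r * Lb) `^ p = (sigma `^ (1 - beta) * (2 * r * Lb)) `^ p.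
    rewrite [RHS]powRM ?(ltW (sigmab0 _)) ?mulr_ge0 ?(ltW sigma0) ?(ltW Lb_gt0)//.
    by rewrite -powRrM mul1r mulfV ?gt_eqF// powRr1// ltW.
  have -> : k * B `^ p = (2 * c * B) `^ p by rewrite powRM// mulr_ge0// ltW.
  have y0 : 0 <= 2 * r * Lb.
    by rewrite !mulr_ge0 ?(ltW sigma0) ?(ltW Lb_gt0).
  have u0 : 0 <= sigma `^ (1 - beta) * (2 * r * Lb) by rewrite mulr_ge0// ltW.
  have v0 : 0 <= 2 * c * B by rewrite !mulr_ge0// ltW.
  rewrite (ge0_ler_powR p0) ?nnegrE//.
  have s2 : sigma `^ (2 - beta) = sigma `^ (1 - beta) * sigma.
    rewrite -[X in _ * X](powRr1 (ltW sigma0)) -powRD.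
      by congr powR; ring.
    by rewrite (gt_eqF sigma0) implybT.
  have -> : sigma `^ (1 - beta) * (2 * r * Lb) = 2 * Lb * (sigma `^ (2 - beta)) * q.
    by rewrite s2 /r /q /D; ring.
  have -> : 2 * c * B = 2 * Lb * (sigma `^ (2 - beta)) * (c * D).
    by rewrite /B /D; ring.
  by rewrite ler_wpM2l// !mulr_ge0 ?(ltW Lb_gt0) ?(ltW (sigmab0 _)).
(* The 2 in [Q] accounts for [2 sigma s <= 2 w]; the other terms only increase under the factor
   [w >= 1]. *)
have sM : sigma * M <= w * Q.
  have -> : sigma * M = 2 * (sigma * s) + 2 * (sigma * (r * L0)) +
      sigma * (2 * r * Lb) `^ p by rewrite /M /growth_bound; ring.
  apply: (@le_trans _ _ (2 * (sigma * s) + (2 * c * A + k * B `^ p))); first by lra.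
  have : 0 <= sigma * s * (2 * c * A + k * B `^ p).
    by rewrite !mulr_ge0// ?addr_ge0// ltW.
  by rewrite /w /Q; lra.
(* [w^beta <= w] takes the weight [1 + sigma s] out of the power; [mulr_powR_interp] then applies to
   [Q] with [a = 2 c A]. *)
have BM : B * (sigma * M) `^ beta <=
    w * (2 * B + 2 * c * A + (k + 1) * B `^ p).
  apply: (@le_trans _ _ (B * (w * Q) `^ beta)).
    rewrite ler_wpM2l// (ge0_ler_powR (ltW beta_gt0)) ?nnegrE ?mulr_ge0//.
    exact: ltW.
  apply: (@le_trans _ _ (w * (B * Q `^ beta))).
    rewrite powRM// [leLHS]mulrCA; apply: ler_wpM2r.
      by rewrite mulr_ge0// powR_ge0.
    by rewrite ler1_powR// ltW.
  by rewrite ler_wpM2l//; exact: mulr_powR_interp.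
have -> : r ^+ 2 * profile L0 Lb beta M = c * A + c * (B * (sigma * M) `^ beta).
  have -> : r ^+ 2 = sigma ^+ 2 * (c * D) by rewrite -q2 /r /q /D; ring.
  rewrite powRM ?(ltW sigma0)// /profile /B.
  have s2 : sigma ^+ 2 = sigma `^ (2 - beta) * sigma `^ beta.
    rewrite -powRD; last by rewrite (gt_eqF sigma0) implybT.
    by rewrite subrK powR_mulrn// ltW.
  by rewrite /A s2 /D; ring.
have {}BM := ler_wpM2l (ltW c0) BM.
have Aw : A <= A * w by rewrite ler_peMr.
have cAw := ler_wpM2l (ltW c0) Aw.
rewrite -/D -/A -/w /profile_const -/k.
apply: (le_trans (lerD cAw BM)).
rewrite -subr_ge0.
set lhs := (X in 0 <= X).
have -> : lhs = c * w * ((3 + k) * A + (2 + 2 * c + k) * B + (3 + 2 * c) * B `^ p).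
  by rewrite /lhs; ring.
by rewrite mulr_ge0 ?addr_ge0// mulr_ge0// ?addr_ge0// ?mulr_ge0// ltW.
Qed.

End growth.

End estimates.

(** * Normalization by the step size *)

Lemma mulr_powR_step (R : realType) (x a eta sigma : R) : 0 < x -> 0 < a ->
  0 <= eta -> 0 <= sigma -> sigma <= eta * x `^ (- (1 / a)) ->
  x * sigma `^ a <= eta `^ a.
Proof.
move=> x0 a0 eta0 sigma0 sx.
(* The exponent [- 1/a] is the one whose [a]-th power cancels the factor [x]. *)
have xa : x * (x `^ (- (1 / a))) `^ a = 1.
  rewrite -powRrM mulNr mul1r mulVf ?gt_eqF// powR_inv1 ?(ltW x0)//.
  by rewrite mulfV// gt_eqF.
rewrite -[leRHS]mul1r -[X in _ <= X * _]xa -mulrA ler_wpM2l ?(ltW x0)// mulrC -powRM ?powR_ge0//.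
by rewrite (ge0_ler_powR (ltW a0)) ?nnegrE ?mulr_ge0 ?powR_ge0.
Qed.

Section step_size.
Context (R : realType) (L0 Lb beta eta : R) (d : nat).
Hypothesis L0_ge0 : 0 <= L0.
Hypothesis Lb_gt0 : 0 < Lb.
Hypothesis d_gt0 : (1 <= d)%N.
Hypothesis eta_gt0 : 0 < eta.

(** For [L0 = 0] the extended minimum is its second argument, hence the guard on the first bound. *)
Lemma step_sizeP (sigma := step_size L0 Lb beta eta d) :
  [/\ 0 < sigma, L0 != 0 -> sigma <= eta * (L0 * d%:R) `^ (- (1 / 2)) &
      sigma <= eta * (Lb * d%:R) `^ (- (1 / (2 - beta)))].
Proof.
rewrite /sigma /step_size; set y := _ `^ (- (1 / (2 - beta))).
have D0 : 0 < d%:R :> R by rewrite ltr0n.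
have y0 : 0 < y by rewrite powR_gt0// mulr_gt0.
have [L00|L0n] := eqVneq L0 0.
  by rewrite minye/=; split => //; rewrite mulr_gt0.
set x := _ `^ (- (1 / 2)).
have x0 : 0 < x by rewrite powR_gt0// mulr_gt0// lt_neqAle eq_sym L0n.
rewrite -EFin_min/=; split; first by rewrite mulr_gt0// lt_min x0.
  by move=> _; rewrite ler_pM2l// ge_min lexx.
by rewrite ler_pM2l// ge_min lexx orbT.
Qed.

End step_size.

(** * The bound on the supremum and the choice of constants *)

Lemma Kdim_profile_le (R : realType) (L0 Lb beta c sigma : R) (d : nat) :
  0 < beta -> beta < 1 -> 1 < c -> 0 <= L0 -> 0 < Lb -> (1 <= d)%N -> 0 < sigma ->
  (Kdim c d sigma (profile L0 Lb beta) <=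
   (profile_const beta c * (L0 * d%:R * sigma ^+ 2
     + Lb * d%:R * sigma `^ (2 - beta)
     + (Lb * d%:R * sigma `^ (2 - beta)) `^ (1 / (1 - beta))))%:E)%E.
Proof.
move=> beta0 beta1 c1 L00 Lb0 d1 sigma0; rewrite /Kdim /Kfun.
set r := sigma * _; set X := profile_const _ _ * _.
have r0 : 0 < r.
  by rewrite mulr_gt0// sqrtr_gt0 mulr_gt0 ?ltr0n// (lt_trans ltr01).
(* [2 X / r^2] bounds every quotient under the supremum, and the prefactor [r^2 / 2] turns it into
   [X]. *)
apply: (@le_trans _ _ ((r ^+ 2 / 2)%:E * (2 * X / r ^+ 2)%:E)%E); last first.
  rewrite -EFinM lee_fin le_eqVlt; apply/orP; left; apply/eqP.
  by field; rewrite gt_eqF.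
rewrite lee_wpmul2l ?lee_fin ?divr_ge0 ?exprn_ge0 ?(ltW r0)//.
apply: ge_ereal_sup => _ [s /= + <-]; rewrite in_itv/= andbT => s0.
have w0 : 0 < 1 + sigma * s by rewrite ltr_pwDl// mulr_ge0// ltW.
rewrite inver gt_eqF// lee_pdivrMr// -EFinM.
(* The level depends on [s]; the denominator [1 + sigma s] compensates its growth. *)
set M := growth_bound beta L0 Lb r s.
apply: (@le_trans _ _ (2 * profile L0 Lb beta M)%:E).
  apply: Gbar_profile_le => //; first exact: ltW.
    exact: growth_bound_gt0.
  exact: growth_boundP.
rewrite lee_fin -(ler_pM2l (exprn_gt0 2 r0)).
have -> : r ^+ 2 * (2 * X / r ^+ 2 * (1 + sigma * s)) = 2 * (X * (1 + sigma * s)).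
  by field; rewrite gt_eqF.
by rewrite mulrCA ler_pM2l//; exact: growth_bound_profile_le.
Qed.

Theorem mainTheorem3 (R : realType) (beta c : R)
    (hbeta0 : 0 < beta) (hbeta1 : beta < 1) (hc : 1 < c) :
  exists C eta0 : R, 0 < eta0 /\
    forall (L0 Lb : R) (d : nat), 0 <= L0 -> 0 < Lb -> (1 <= d)%N ->
      (forall sigma : R, 0 < sigma ->
        (Kdim c d sigma (profile L0 Lb beta) <=
           (C * (L0 * d%:R * sigma ^+ 2
                 + Lb * d%:R * sigma `^ (2 - beta)
                 + (Lb * d%:R * sigma `^ (2 - beta)) `^ (1 / (1 - beta))))%:E)%E)
      /\
      (forall eta : R, 0 < eta -> eta <= eta0 ->
        (Kdim c d (step_size L0 Lb beta eta d) (profile L0 Lb beta)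
           <= (1 / 4)%:E)%E).
Proof.
pose C := profile_const beta c.
have C0 : 0 < C.
  by rewrite mulr_gt0 ?ltr_pwDl ?powR_ge0//; lra.
(* [eta <= 1] makes each of the three terms at most [eta], and [eta <= 1 / (12 C)] then gives
   [3 C eta <= 1/4]. *)
exists C, (Num.min 1 (12 * C)^-1); split.
  by rewrite lt_min ltr01 invr_gt0 mulr_gt0.
move=> L0 Lb d L00 Lb0 d1; split=> [sigma sigma0|eta eta0].
  exact: Kdim_profile_le.
rewrite le_min => /andP[eta1 etaC].
have D0 : 0 < d%:R :> R by rewrite ltr0n.
have [sigma0 sA sB] := step_sizeP beta L00 Lb0 d1 eta0.
set sigma := step_size _ _ _ _ _ in sigma0 sA sB *.
apply: (le_trans (Kdim_profile_le hbeta0 hbeta1 hc L00 Lb0 d1 sigma0)).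
rewrite lee_fin -/C; set B := Lb * d%:R * _.
have eta01 : 0 < eta <= 1 by rewrite eta0.
have A_le : L0 * d%:R * sigma ^+ 2 <= eta.
  have [L0z|L0n] := eqVneq L0 0; first by rewrite L0z !mul0r ltW.
  rewrite -powR_mulrn ?(ltW sigma0)//.
  apply: (@le_trans _ _ (eta `^ 2)); last by rewrite ge1r_powR// ler1n.
  apply: mulr_powR_step => //; rewrite ?(ltW eta0) ?(ltW sigma0) ?sA//.
  by rewrite mulr_gt0// lt_neqAle eq_sym L0n.
have B_le : B <= eta.
  apply: (@le_trans _ _ (eta `^ (2 - beta))); last by rewrite ge1r_powR//; lra.
  apply: mulr_powR_step => //; rewrite ?(ltW eta0) ?(ltW sigma0)//.
    by rewrite mulr_gt0.
  by lra.
have B0 : 0 < B by rewrite !mulr_gt0 ?powR_gt0.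
have Bp_le : B `^ (1 / (1 - beta)) <= eta.
  (* As [B <= eta <= 1] and the exponent is at least 1, the power is at most [B]. *)
  apply: le_trans (B_le); apply: ge1r_powR; first by rewrite B0 (le_trans B_le).
  by rewrite ler_pdivlMr ?subr_gt0//; lra.
apply: (@le_trans _ _ (C * (3 * eta))).
  by rewrite ler_wpM2l ?(ltW C0)//; lra.
have : C * eta <= C * (12 * C)^-1 by rewrite ler_wpM2l// ltW.
have -> : C * (12 * C)^-1 = 1 / 12 by field; rewrite gt_eqF.
by lra.
Qed.
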